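(* Let $X$ be a normed linear space (real or complex) and let $x, y \in S_X$ satisfy $\|x + \lambda y\| \ge 1$ for all scalars $\lambda$. Then there exists $\delta \ge \frac{1}{2}$ such that $\|y + \lambda x\| \ge \delta$ for all scalars $\lambda$. If in addition $X$ is strictly convex, then such a $\delta$ exists with $\delta > \frac{1}{2}$.
   Context: $S_X = \{x \in X : \|x\| = 1\}$ and $B_X = \{x \in X : \|x\| \le 1\}$. $X$ is strictly convex iff every element of $S_X$ is an extreme point of $B_X$. *)

(* Defs.v *)
From HB Require Import structures.
From mathcomp Require Import all_boot all_order all_algebra.
From mathcomp Require Import complex.
From mathcomp Require Import classical_sets reals normedtype.

Set Implicit Arguments.
Unset Strict Implicit.
Unset Printing Implicit Defensive.

Import Order.TTheory GRing.Theory Num.Theory.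
Import numFieldNormedType.Exports.
Local Open Scope classical_set_scope.
Local Open Scope ring_scope.

Definition unit_sphere (K : numFieldType) (X : normedModType K) : set X :=
  [set x | `|x| = 1].
Arguments unit_sphere {K} X.

Definition unit_ball (K : numFieldType) (X : normedModType K) : set X :=
  [set x | `|x| <= 1].
Arguments unit_ball {K} X.

(* For K = R[i] the order is the partial order in which 0 < t forces t to be
   real, so t ranges over the real interval ]0, 1[ for both scalar fields. *)
Definition extreme_point (K : numFieldType) (X : normedModType K)
    (A : set X) (x : X) : Prop :=
  A x /\
  forall (u v : X) (t : K), A u -> A v -> 0 < t -> t < 1 ->
    x = (1 - t) *: u + t *: v -> u = x /\ v = x.

Definition strictly_convex (K : numFieldType) (X : normedModType K) : Prop :=
  forall x : X, unit_sphere X x -> extreme_point (unit_ball X) x.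

(* Main.v *)
Require Import Defs.
From mathcomp Require Import all_boot all_order all_algebra.
From mathcomp Require Import complex.
From mathcomp Require Import classical_sets reals normedtype.
From mathcomp Require Import boolp topology derive lra.
Import Order.TTheory GRing.Theory Num.Theory.
Import numFieldNormedType.Exports.
Local Open Scope ring_scope.
Local Open Scope complex_scope.

(** Writing [l *: (x + l^-1 *: y)] for [y + l *: x] gives [`|l| <= `|y + l *: x|],
    while [1 <= `|l| + `|y + l *: x|] by the triangle inequality; hence the
    constant [1/2].  If [`|y + l *: x| = 1/2], then [`|l| <= 1/2] and [y] is the
    midpoint of [2 *: (y + l *: x)] and [- 2 *: l *: x], two points of the unit ball.
    For an extreme point [y] this forces [y + 2 *: l *: x = 0], against the
    first inequality.  A strict bound valid for every [l] becomes a uniform one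
    because only the [l] of a compact set matter: the others have norm at
    least 1. *)

Section ReversedOrthogonality.
Context {K : numFieldType} {X : normedModType K} {x y : X}.
Hypothesis x_orth_y : forall l : K, 1 <= `|x + l *: y|.

Lemma norm_scalar_le (l : K) : `|l| <= `|y + l *: x|.
Proof.
have [->|l0] := eqVneq l 0; first by rewrite normr0.
have -> : y + l *: x = l *: (x + l^-1 *: y).
  by rewrite scalerDr scalerA divff // scale1r addrC.
by rewrite normrZ ler_peMr.
Qed.

Hypotheses (x1 : `|x| = 1) (y1 : `|y| = 1).

Lemma half_le_norm (l : K) : 2^-1 <= `|y + l *: x|.
Proof.
have h : 1 <= `|y + l *: x| + `|l|.
  rewrite -y1 -[X in X <= _](congr1 (@Num.norm _ _) (addrK (l *: x) y)).
  by rewrite (le_trans (ler_normB _ _)) // normrZ x1 mulr1.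
rewrite -[leLHS]mul1r ler_pdivrMr ?ltr0n // mulr_natr mulr2n.
by rewrite (le_trans h) // lerD2l norm_scalar_le.
Qed.

Lemma half_lt_norm (l : K) :
  strictly_convex X -> 2^-1 < `|y + l *: x|.
Proof.
move=> scX; rewrite lt_neqAle half_le_norm andbT; apply/eqP => /esym hl.
have two0 : (2 : K) != 0 by rewrite pnatr_eq0.
have [_ ext] := scX y y1.
have half1 : 1 - 2^-1 = 2^-1 :> K.
  by apply: (mulIf two0); rewrite mulrBl mulVf // mul1r -[2]/(1 + 1) addrK.
have [|||||_ ylx] := ext (2 *: (y + l *: x)) (- (2 * l) *: x) 2^-1.
- by rewrite /unit_ball /= normrZ hl normr_nat divff.
- rewrite /unit_ball /= normrZ x1 mulr1 normrN normrM normr_nat.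
  rewrite -[leRHS](divff two0) ler_pM2l ?ltr0n //.
  by rewrite -hl norm_scalar_le.
- by rewrite invr_gt0 ltr0n.
- by rewrite invf_lt1 ?ltr0n // ltr1n.
- rewrite half1 !scalerA mulVf // scale1r mulrN mulKf //.
  by rewrite scaleNr addrK.
(* Since [y] equals [- (2 * l) *: x], the bound at [2 * l] reads [|2 * l| <= 0]; so [y] vanishes,
   contrary to its norm being 1. *)
have := norm_scalar_le (2 * l).
rewrite -[X in X + _]ylx -scalerDl addNr scale0r normr0 normr_le0 => /eqP l0.
by move: y1; rewrite -ylx l0 oppr0 scale0r normr0 => /eqP; rewrite eq_sym oner_eq0.
Qed.

End ReversedOrthogonality.

(** On a nonempty [A] the minimum of [f] is attained, hence exceeds [c]; off [A] the bound [d] takes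
    over. *)
Lemma uniform_lower_bound (R : realType) (T : topologicalType) (A : set T)
    (f : T -> R) (c d : R) :
  compact A -> continuous f -> (forall t, c < f t) ->
  c < d -> (forall t, ~ A t -> d <= f t) ->
  exists delta, c < delta /\ forall t, delta <= f t.
Proof.
move=> cA cf cltf cd dlef.
have [A0|/set0P A0] := eqVneq A set0.
  by exists d; split => // t; apply: dlef; rewrite A0.
have [t0 _ t0min] : exists2 t0, t0 \in A & forall t, t \in A -> f t0 <= f t.
  by apply: compact_EVT_min => //; exact: continuous_subspaceT.
exists (Num.min (f t0) d); split; first by rewrite lt_min cltf.
move=> t; rewrite ge_min; have [At|/dlef ->] := pselect (A t); last by rewrite orbT.
by rewrite t0min ?inE.
Qed.

(** Being nonnegative in [R[i]] entails a zero imaginary part. This carries norm inequalities over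
    to [R], where minima are taken. *)
Lemma complex_norm_ReE (R : rcfType) (V : normedZmodType R[i]) (v : V) :
  `|v| = (complex.Re `|v|)%:C.
Proof.
by have := normr_ge0 v; case: (`|v|) => a b; rewrite lecE /= => /andP[/eqP-> _].
Qed.

Lemma normc_le_abs (R : rcfType) (a b : R) : `|a +i* b| <= (`|a| + `|b|)%:C.
Proof.
rewrite [a +i* b]complex.complexE (le_trans (ler_normD _ _)) //= normrM rmorphD /=.
by rewrite !normc_def /= !expr0n /= !addr0 add0r expr1n sqrtr1 mul1r !sqrtr_sqr.
Qed.

Lemma normc_ge_abs (R : rcfType) (a b : R) :
  (`|a|%:C <= `|a +i* b|) /\ (`|b|%:C <= `|a +i* b|).
Proof.
rewrite normc_def /= !lecR -!sqrtr_sqr !ler_sqrt ?addr_ge0 ?sqr_ge0 //.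
by rewrite lerDl lerDr !sqr_ge0.
Qed.

(** By the reverse triangle inequality the map is Lipschitz for the sum of coordinate distances,
    with constant the norm of [x]. *)
Lemma continuous_Re_norm_affine (R : realType) (X : normedModType R[i]) (x y : X) :
  continuous (fun p : R * R => complex.Re `|y + (p.1 +i* p.2) *: x|).
Proof.
have lip (p q : R * R) :
    `|complex.Re `|y + (p.1 +i* p.2) *: x| - complex.Re `|y + (q.1 +i* q.2) *: x| |
      <= (`|p.1 - q.1| + `|p.2 - q.2|) * complex.Re `|x|.
  have real_norm (r : R) : `|r|%:C = `|r%:C|.
    by rewrite normc_def /= expr0n /= addr0 sqrtr_sqr.
  rewrite -lecR real_norm rmorphB /= -!complex_norm_ReE.
  rewrite (le_trans (ler_dist_dist _ _)) // opprD addrACA subrr add0r -scalerBl.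
  by rewrite normrZ rmorphM /= -complex_norm_ReE ler_wpM2r // normc_le_abs.
move=> p; apply/cvgrPdist_le => e e0.
have M0 : 0 <= complex.Re `|x|.
  by rewrite -lecR -complex_norm_ReE; exact: normr_ge0.
(* Each coordinate accounts for [e / 2]; adding 1 keeps the divisor positive even if [x] has norm
   0. *)
have d0 : 0 < e / 2 / (complex.Re `|x| + 1) by rewrite !divr_gt0 // ltr_wpDl.
near=> q; rewrite (le_trans (lip p q)) //.
have q1 : `|p.1 - q.1| <= e / 2 / (complex.Re `|x| + 1).
  near: q; have/cvgrPdist_le : (@fst R R @ p --> p.1)%classic by exact: cvg_fst.
  exact.
have q2 : `|p.2 - q.2| <= e / 2 / (complex.Re `|x| + 1).
  near: q; have/cvgrPdist_le : (@snd R R @ p --> p.2)%classic by exact: cvg_snd.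
  exact.
apply: le_trans (_ : _ <= (`|p.1 - q.1| + `|p.2 - q.2|) * (complex.Re `|x| + 1)) _.
  by rewrite ler_wpM2l ?addr_ge0 // lerDl.
by rewrite -ler_pdivlMr ?ltr_wpDl // {1}[e]splitr mulrDl lerD.
Unshelve. all: by end_near. Qed.

Theorem theorem2p9 (R : realType) :
  (* real scalars *)
  (forall (X : normedModType R) (x y : X),
     unit_sphere X x -> unit_sphere X y ->
     (forall l : R, 1 <= `|x + l *: y|) ->
     (exists delta : R, 2^-1 <= delta /\
        forall l : R, delta <= `|y + l *: x|) /\
     (strictly_convex X ->
      exists delta : R, 2^-1 < delta /\
        forall l : R, delta <= `|y + l *: x|)) /\
  (* complex scalars: the norm takes its (real) values in R[i] *)
  (forall (X : normedModType R[i]) (x y : X),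
     unit_sphere X x -> unit_sphere X y ->
     (forall l : R[i], 1 <= `|x + l *: y|) ->
     (exists delta : R, 2^-1 <= delta /\
        forall l : R[i], delta%:C <= `|y + l *: x|) /\
     (strictly_convex X ->
      exists delta : R, 2^-1 < delta /\
        forall l : R[i], delta%:C <= `|y + l *: x|)).
Proof.
split=> X x y x1 y1 xy; split.
- by exists 2^-1; split => // l; exact: half_le_norm.
(* Outside the segment [|l| > 1], and [norm_scalar_le] passes this on to [y + l *: x]. *)
- move=> scX; apply: (@uniform_lower_bound R R `[-1, 1]%classic _ _ 1).
  + exact: segment_compact.
  + move=> l; apply: cvg_norm; apply: cvgD; first exact: cvg_cst.
    by apply: cvgZr_tmp; exact: cvg_id.
  + by move=> l; exact: half_lt_norm.
  + by lra.
  + move=> l /= l1; rewrite (le_trans _ (norm_scalar_le xy l)) // leNgt.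
    by apply/negP => /ltW; rewrite ler_norml => ?; apply: l1; rewrite in_itv.
- exists 2^-1; split => // l; rewrite fmorphV rmorph_nat; exact: half_le_norm.
- move=> scX.
  suff [d [d2 hd]] : exists d : R, 2^-1 < d /\
      forall p : R * R, d <= complex.Re `|y + (p.1 +i* p.2) *: x|.
    exists d; split => // -[a b].
    by rewrite complex_norm_ReE lecR; exact: (hd (a, b)).
  (* The square replaces the unit disc: outside it some coordinate, hence the modulus of the scalar,
     exceeds 1. *)
  apply: (@uniform_lower_bound R (R * R)%type (`[-1, 1] `*` `[-1, 1])%classic
    _ _ 1).
  + by apply: compact_setX; exact: segment_compact.
  + exact: continuous_Re_norm_affine.
  + move=> p; rewrite -ltcR -complex_norm_ReE fmorphV rmorph_nat.
    exact: half_lt_norm.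
  + by lra.
  + move=> [a b] /= ab1; rewrite -lecR -complex_norm_ReE.
    rewrite (le_trans _ (norm_scalar_le xy _)) //.
    have [ha hb] := normc_ge_abs R a b.
    have [a1|a1] := leP 1 `|a|; first by apply: le_trans ha; rewrite lecR.
    have [b1|b1] := leP 1 `|b|; first by apply: le_trans hb; rewrite lecR.
    by case: ab1; split; rewrite /= in_itv /= -ler_norml ltW.
Qed.
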